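(* Let $f=(p,q):\overline{(U,E)}\to\overline{(V,E')}$ be a hesitant fuzzy soft mapping and let $i=(l,m):\overline{(U,E)}\to\overline{(U,E)}$ and $j=(g,h):\overline{(V,E')}\to\overline{(V,E')}$ be hesitant fuzzy soft identity mappings. Then $f\circ i=f$ and $j\circ f=f$.
   Context: All universes ($U,V$) and attribute (parameter) sets ($E,E'$) are nonempty sets. A hesitant fuzzy element (HFE) is a nonempty subset of $[0,1]$. A hesitant fuzzy set on $U$ assigns to each $x\in U$ an HFE. A hesitant fuzzy soft set $F_A$ over $U$ with attributes from $E$ is given by a nonempty $A\subseteq E$ and, for each $e\in A$, a hesitant fuzzy set $F(e)$ on $U$; write $F_A(e)(x)$ for the HFE of $x\in U$ at $e$. By convention $F_A(e)(x)=\{0\}$ for $e\in E\setminus A$, and two hesitant fuzzy soft sets over $U$ with attributes from $E$ are equal when they agree as functions of $(e,x)\in E\times U$. The hesitant fuzzy soft class $\overline{(U,E)}$ is the collection of all hesitant fuzzy soft sets over $U$ with attributes from $E$. The union of HFEs is $\mu_1\cup\mu_2=\{\max(\gamma_1,\gamma_2):\gamma_1\in\mu_1,\gamma_2\in\mu_2\}$; for a nonempty family, $\bigcup_i\mu_i=\{\sup_i\gamma_i:\gamma_i\in\mu_i \text{ for all } i\}$ (so the maximum for finite families), and the union of the empty family is $\{0\}$. Given maps $p:U\to V$ and $q:E\to E'$, the hesitant fuzzy soft mapping $f=(p,q):\overline{(U,E)}\to\overline{(V,E')}$ sends $F_A$ to its image $f(F_A)$ defined, for $\beta\in E'$ and $y\in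 V$, by $f(F_A)(\beta)(y)=\bigcup_{\alpha\in q^{-1}(\beta)\cap A,\ s\in p^{-1}(y)}F_A(\alpha)(s)$. Two hesitant fuzzy soft mappings are equal when they are equal as mappings between classes. A hesitant fuzzy soft mapping $(l,m):\overline{(U,E)}\to\overline{(U,E)}$ is a hesitant fuzzy soft identity mapping if both $l:U\to U$ and $m:E\to E$ are identity mappings. The composite of hesitant fuzzy soft mappings $f_1=(p_1,q_1):\overline{(U,E)}\to\overline{(V,E')}$ and $f_2=(p_2,q_2):\overline{(V,E')}\to\overline{(W,E'')}$ is the hesitant fuzzy soft mapping $f_2\circ f_1:\overline{(U,E)}\to\overline{(W,E'')}$ satisfying $(f_2\circ f_1)(F_A)=f_2(f_1(F_A))$ for every $F_A\in\overline{(U,E)}$; its underlying pair of maps is $(p_2\circ p_1,\,q_2\circ q_1)$. *)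

(* Defs.v *)
From mathcomp Require Import all_boot all_order all_algebra.
From mathcomp Require Import boolp classical_sets reals.
Set Implicit Arguments. Unset Strict Implicit. Unset Printing Implicit Defensive.
Import Order.TTheory GRing.Theory Num.Theory.
Local Open Scope classical_set_scope.
Local Open Scope ring_scope.

Record hfe (R : realType) := Hfe {
  hfe_set :> set R;
  hfe_nonempty : hfe_set !=set0;
  hfe_itv : forall t, hfe_set t -> 0 <= t <= 1 }.

(* Union of the family of HFEs [mu i] indexed by the [i] in [D]: the set of all
   suprema of selections [gamma i \in mu i]; the empty union is {0}. *)
Definition hfe_bigU (R : realType) (I : Type) (D : set I) (mu : I -> hfe R) :
    set R :=
  if `[< D = set0 >] then [set 0]
  else [set sup (gamma @` D)
       | gamma in [set gamma : I -> R | forall i, D i -> hfe_set (mu i) (gamma i)]].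

Definition hfset (R : realType) (U : Type) := U -> hfe R.

(* [hfss_val] is total: outside the attribute set it takes the conventional
   value {0}. *)
Record hfss (R : realType) (U E : Type) := Hfss {
  hfss_attr : set E;
  hfss_attr_nonempty : hfss_attr !=set0;
  hfss_val :> E -> hfset R U;
  hfss_out : forall e, ~ hfss_attr e ->
               forall x, hfss_val e x = [set 0] :> set R }.

(* Two soft sets are identified when they agree as functions on E x U, even if
   their attribute sets differ. *)
Definition hfss_eq (R : realType) (U E : Type) (F G : hfss R U E) : Prop :=
  forall e x, F e x = G e x :> set R.

(* The pairs (alpha, s) with alpha \in q^-1(beta) :&: A and s \in p^-1(y). *)
Definition fiber (U V E E' : Type) (p : U -> V) (q : E -> E') (A : set E)
    (beta : E') (y : V) : set (E * U) :=
  [set i | (q i.1 = beta /\ A i.1) /\ p i.2 = y].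

(* [isSup0 D gamma t]: t is the supremum of the gamma i, i \in D, computed in
   the nonnegative reals, so that it is 0 when D is empty. *)
Definition isSup0 (R : realType) (I : Type) (D : set I) (gamma : I -> R)
    (t : R) : Prop :=
  [/\ 0 <= t, forall i, D i -> gamma i <= t &
      forall u, 0 <= u -> (forall i, D i -> gamma i <= u) -> t <= u].

Lemma isSup0_uniq (R : realType) (I : Type) (D : set I) (gamma : I -> R)
    (t u : R) : isSup0 D gamma t -> isSup0 D gamma u -> t = u.
Proof.
move=> [t0 tD tl] [u0 uD ul]; apply/eqP; rewrite eq_le.
by rewrite (tl _ u0 uD) (ul _ t0 tD).
Qed.

Lemma isSup0_sup (R : realType) (I : Type) (D : set I) (gamma : I -> R) :
  (forall i, D i -> 0 <= gamma i <= 1) ->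
  isSup0 D gamma (sup (gamma @` D)).
Proof.
move=> g01; have [D0|/set0P [i0 Di0]] := eqVneq D set0.
  by rewrite D0 image_set0 sup0; split.
have ub : has_ubound (gamma @` D).
  by exists 1 => _ [i Di <-]; case/andP: (g01 i Di).
have le i : D i -> gamma i <= sup (gamma @` D).
  by move=> Di; apply: (ub_le_sup ub); exists i.
split => //.
  by apply: le_trans (le i0 Di0); case/andP: (g01 i0 Di0).
move=> u _ uD; apply: ge_sup; first by exists (gamma i0), i0.
by move=> _ [i Di <-]; apply: uD.
Qed.

Lemma hfe_bigUP (R : realType) (I : Type) (D : set I) (mu : I -> hfe R) t :
  hfe_bigU D mu t <->
  exists2 gamma : I -> R,
    (forall i, D i -> hfe_set (mu i) (gamma i)) & isSup0 D gamma t.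
Proof.
rewrite /hfe_bigU; case: asboolP => [D0|nD0]; split.
- by move=> /= ->; exists (fun=> 0); rewrite D0 //; split.
- move=> [gamma _ [t0 _ tl]] /=; apply/eqP; rewrite eq_le t0 andbT.
  by apply: tl => //; rewrite D0.
- move=> [gamma gmu <-]; exists gamma => //; apply: isSup0_sup => i Di.
  exact: (hfe_itv (gmu i Di)).
- move=> [gamma gmu gt]; exists gamma => //; apply: isSup0_uniq gt.
  by apply: isSup0_sup => i Di; exact: (hfe_itv (gmu i Di)).
Qed.

Lemma hfe_bigU_nonempty (R : realType) (I : Type) (D : set I)
    (mu : I -> hfe R) : hfe_bigU D mu !=set0.
Proof.
have [gamma gmu] := choice (fun i => hfe_nonempty (mu i)).
exists (sup (gamma @` D)); apply/hfe_bigUP; exists gamma => //.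
by apply: isSup0_sup => i _; exact: (hfe_itv (gmu i)).
Qed.

Lemma hfe_bigU_itv (R : realType) (I : Type) (D : set I) (mu : I -> hfe R) t :
  hfe_bigU D mu t -> 0 <= t <= 1.
Proof.
move=> /hfe_bigUP [gamma gmu [t0 tD tl]]; rewrite t0 /=.
by apply: tl => // i Di; case/andP: (hfe_itv (gmu i Di)).
Qed.

Definition hfe_union (R : realType) (I : Type) (D : set I) (mu : I -> hfe R) :
    hfe R :=
  Hfe (hfe_bigU_nonempty D mu) (@hfe_bigU_itv R I D mu).

Lemma hfss_image_out (R : realType) (U V E E' : Type) (p : U -> V)
    (q : E -> E') (F : hfss R U E) beta :
  ~ (q @` hfss_attr F) beta ->
  forall y, hfe_union (fiber p q (hfss_attr F) beta y)
              (fun i => F i.1 i.2) = [set 0] :> set R.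
Proof.
move=> nb y; rewrite /= /hfe_bigU; case: asboolP => // -[].
apply/seteqP; split => // -[a s] [[/= qa Aa] _]; apply: nb.
by exists a.
Qed.

Definition hfss_image (R : realType) (U V E E' : Type) (p : U -> V)
    (q : E -> E') (F : hfss R U E) : hfss R V E' :=
  Hfss (image_nonempty q (hfss_attr_nonempty F))
       (@hfss_image_out R U V E E' p q F).

(* A hesitant fuzzy soft mapping (p, q), with its action on the class of soft
   sets; [hfsm_actE] determines that action up to [hfss_eq]. *)
Record hfsm (R : realType) (U V E E' : Type) := Hfsm {
  hfsm_p : U -> V;
  hfsm_q : E -> E';
  hfsm_act :> hfss R U E -> hfss R V E';
  hfsm_actE : forall F, hfss_eq (hfsm_act F) (hfss_image hfsm_p hfsm_q F) }.

Definition hfsm_of (R : realType) (U V E E' : Type) (p : U -> V)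
    (q : E -> E') : hfsm R U V E E' :=
  @Hfsm R U V E E' p q (hfss_image p q) (fun _ _ _ => erefl).

Definition hfsm_eq (R : realType) (U V E E' : Type)
    (f g : hfsm R U V E E') : Prop :=
  forall F, hfss_eq (f F) (g F).

Definition is_identity_hfsm (R : realType) (U E : Type)
    (i : hfsm R U U E E) : Prop :=
  hfsm_p i =1 id /\ hfsm_q i =1 id.

Lemma hfe_bigU_subset (R : realType) (I : Type) (D T : set I)
    (mu nu : I -> hfe R) :
  D `<=` T -> (forall i, D i -> mu i = nu i :> set R) ->
  (forall i, T i -> ~ D i -> nu i = [set 0] :> set R) ->
  hfe_bigU D mu = hfe_bigU T nu.
Proof.
move=> DT munu nu0; apply/seteqP; split => t /hfe_bigUP [gamma gmu gt];
  apply/hfe_bigUP.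
- exists (fun i => if `[< D i >] then gamma i else 0).
    move=> i Ti; case: asboolP => [Di|nDi]; last by rewrite nu0.
    by rewrite -munu //; apply: gmu.
  case: gt => t0 tD tl; split => //.
    by move=> i Ti; case: asboolP => // /tD.
  move=> u u0 uT; apply: tl => // i Di.
  by have := uT i (DT i Di); case: asboolP.
- exists gamma; first by move=> i Di; rewrite munu //; apply/gmu/DT.
  case: gt => t0 tD tl; split => //; first by move=> i /DT; apply: tD.
  move=> u u0 uD; apply: tl => // i Ti.
  case: (pselect (D i)) => [/uD //|nDi].
  by have := gmu i Ti; rewrite nu0 //= => ->.
Qed.

Lemma hfe_bigU_fiber (R : realType) (I J : Type) (h : J -> I) (D : set I)
    (mu : I -> hfe R) (nu : J -> hfe R) :
  (forall i, D i -> mu i = hfe_bigU [set j | h j = i] nu :> set R) ->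
  hfe_bigU D mu = hfe_bigU [set j | D (h j)] nu.
Proof.
move=> munu; apply/seteqP; split => t /hfe_bigUP [gamma gmu [t0 tD tl]];
  apply/hfe_bigUP.
- have /choice [g gP] : forall i, exists g : J -> R, D i ->
      (forall j, h j = i -> hfe_set (nu j) (g j)) /\
      isSup0 [set j | h j = i] g (gamma i).
    move=> i; case: (pselect (D i)) => [Di|]; last by exists (fun=> 0).
    have := gmu i Di; rewrite munu // => /hfe_bigUP [g g1 g2].
    by exists g.
  exists (fun j => g (h j) j); first by move=> j /gP [+ _]; apply.
  split => //.
    move=> j Dj; have [_ [_ le _]] := gP _ Dj.
    by apply: le_trans (tD _ Dj); apply: le.
  move=> u u0 uD; apply: tl => // i Di; have [_ [_ _]] := gP _ Di.
  by apply => // j /= hj; subst i; apply: uD.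
- pose s i := sup (gamma @` [set j | h j = i]).
  have sP i : D i -> isSup0 [set j | h j = i] gamma (s i).
    move=> Di; apply: isSup0_sup => j /= hj; subst i.
    exact: (hfe_itv (gmu j Di)).
  exists s.
    move=> i Di; rewrite munu //; apply/hfe_bigUP; exists gamma; last exact: sP.
    by move=> j /= hj; subst i; apply: gmu.
  split => //.
    move=> i Di; have [_ _] := sP i Di; apply => // j /= hj; subst i.
    exact: tD.
  move=> u u0 uD; apply: tl => // j Dj; have [_ le _] := sP _ Dj.
  by apply: le_trans (uD _ Dj); apply: le.
Qed.

Lemma hfss_imageT (R : realType) (U V E E' : Type) (p : U -> V) (q : E -> E')
    (F : hfss R U E) beta y :
  hfss_image p q F beta y =
  hfe_bigU [set i | (q i.1, p i.2) = (beta, y)] (fun i => F i.1 i.2) :> set R.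
Proof.
apply: hfe_bigU_subset => //.
  by move=> [a s] [[/= <- _] <-].
move=> [a s] [/= qa ps] nD; apply: hfss_out => Aa; exact: nD.
Qed.

Lemma hfss_image_eq (R : realType) (U V E E' : Type) (p : U -> V)
    (q : E -> E') (F G : hfss R U E) :
  hfss_eq F G -> hfss_eq (hfss_image p q F) (hfss_image p q G).
Proof.
by move=> FG beta y; rewrite !hfss_imageT; apply: hfe_bigU_subset.
Qed.

Lemma hfss_image_comp (R : realType) (U V W E E' E'' : Type)
    (p1 : U -> V) (q1 : E -> E') (p2 : V -> W) (q2 : E' -> E'')
    (F : hfss R U E) :
  hfss_eq (hfss_image p2 q2 (hfss_image p1 q1 F))
          (hfss_image (p2 \o p1) (q2 \o q1) F).
Proof.
move=> beta y; rewrite !hfss_imageT.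
apply: (@hfe_bigU_fiber _ _ _ (fun i => (q1 i.1, p1 i.2))
          [set i | (q2 i.1, p2 i.2) = (beta, y)]) => -[b z] _.
exact: hfss_imageT.
Qed.

Lemma hfsm_comp_actE (R : realType) (U V W E E' E'' : Type)
    (f2 : hfsm R V W E' E'') (f1 : hfsm R U V E E') (F : hfss R U E) :
  hfss_eq (f2 (f1 F))
    (hfss_image (hfsm_p f2 \o hfsm_p f1) (hfsm_q f2 \o hfsm_q f1) F).
Proof.
move=> beta y; rewrite hfsm_actE.
rewrite (hfss_image_eq _ _ (hfsm_actE f1 F)).
exact: hfss_image_comp.
Qed.

Definition hfsm_comp (R : realType) (U V W E E' E'' : Type)
    (f2 : hfsm R V W E' E'') (f1 : hfsm R U V E E') : hfsm R U W E E'' :=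
  @Hfsm R U W E E'' (hfsm_p f2 \o hfsm_p f1) (hfsm_q f2 \o hfsm_q f1)
    (fun F => f2 (f1 F)) (hfsm_comp_actE f2 f1).

(* Main.v *)
Require Import Defs.
From mathcomp Require Import all_boot all_order all_algebra.
From mathcomp Require Import boolp classical_sets reals.

(** Under the identity pair, the value of an image at [(e, x)] is the union of
    a family indexed by the single pair [(e, x)]; such a union is its only
    member, so an identity mapping fixes every soft set up to [hfss_eq]
    ([identity_hfsm_act]). The law [j \o f = f] is then immediate. For
    [f \o i = f] one also needs that [f] respects [hfss_eq] ([hfsm_act_eq]),
    because [i F] is only known to agree with [F] as a function: its attribute
    set may differ from that of [F]. *)

Local Open Scope classical_set_scope.
Local Open Scope ring_scope.

Lemma isSup0_set1 (R : realType) (I : Type) (a : I) (gamma : I -> R) :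
  0 <= gamma a -> isSup0 [set a] gamma (gamma a).
Proof. by move=> ga0; split=> // [_ ->|u _]; last apply. Qed.

(** A selection over one index is one member of [mu a], and it is its own
    supremum: members lie in the unit interval, so the lower bound 0 that
    [isSup0] imposes does not raise it. *)
Lemma hfe_bigU_set1 (R : realType) (I : Type) (a : I) (mu : I -> hfe R) :
  hfe_bigU [set a] mu = mu a :> set R.
Proof.
apply/seteqP; split=> t.
- move=> /hfe_bigUP [gamma /(_ a erefl) mu_ga sup_t].
  have /andP[ga0 _] := hfe_itv mu_ga.
  by rewrite (isSup0_uniq sup_t (isSup0_set1 _ _ _ _ ga0)).
- move=> mu_t; apply/hfe_bigUP; exists (fun=> t); first by move=> _ ->.
  by apply: isSup0_set1; have /andP[] := hfe_itv mu_t.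
Qed.

Lemma hfss_image_id (R : realType) (U E : Type) (F : hfss R U E) :
  hfss_eq (hfss_image id id F) F.
Proof.
move=> e x; rewrite hfss_imageT.
have -> : [set k : E * U | (id k.1, id k.2) = (e, x)] = [set (e, x)].
  by apply/seteqP; split=> -[a s].
exact: hfe_bigU_set1.
Qed.

Lemma identity_hfsm_act (R : realType) (U E : Type) (i : hfsm R U U E E) :
  is_identity_hfsm i -> forall F, hfss_eq (i F) F.
Proof.
move=> [/funext p_id /funext q_id] F e x.
by rewrite hfsm_actE p_id q_id hfss_image_id.
Qed.

Lemma hfsm_act_eq (R : realType) (U V E E' : Type) (f : hfsm R U V E E')
    (F G : hfss R U E) :
  hfss_eq F G -> hfss_eq (f F) (f G).
Proof. by move=> FG b y; rewrite !hfsm_actE (hfss_image_eq _ _ FG). Qed.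

Theorem theorem3p17 (R : realType) (U V E E' : Type)
    (hU : inhabited U) (hV : inhabited V)
    (hE : inhabited E) (hE' : inhabited E')
    (f : hfsm R U V E E') (i : hfsm R U U E E) (j : hfsm R V V E' E')
    (hi : is_identity_hfsm i) (hj : is_identity_hfsm j) :
  hfsm_eq (hfsm_comp f i) f /\ hfsm_eq (hfsm_comp j f) f.
Proof.
split=> F; last exact: identity_hfsm_act.
by apply: (hfsm_act_eq _ _ _ _ _ f); exact: identity_hfsm_act.
Qed.
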